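(* For all odd $n\in\mathbb{N}$, $$\frac1{2n}\tilde\omega_n=\frac1n\Big(\Pi^\emptyset+2\sum_{k=2}^{n-1}(-1)^{k-1}\Pi^{\{k\}}\Big).$$
   Context: Let $K$ be a field of characteristic $0$. Permutations act on the right ($i\pi$ is the image of $i$) and products in $S_n$ are read from left to right (first $\pi$, then $\sigma$ in $\pi\sigma$). For $\pi\in S_n$: $\mathrm{Des}(\pi)=\{1\le i\le n-1\mid i\pi>(i+1)\pi\}$, $\mathrm{Peak}(\pi)=\{2\le i\le n-1\mid (i-1)\pi<i\pi>(i+1)\pi\}$. In $KS_n$ put $\Delta^D=\sum_{\mathrm{Des}(\pi)=D}\pi$ for $D\subseteq\{1,\ldots,n-1\}$ and $\Pi^P=\sum_{\mathrm{Peak}(\pi)=P}\pi$ for $P\subseteq\{2,\ldots,n-1\}$. $\tilde\Xi^n:=2\Pi^\emptyset$; $\omega_n:=\sum_{k=0}^{n-1}(-1)^k\Delta^{\{1,\ldots,k\}}$ (the Dynkin operator); $\tilde\omega_n:=\omega_n\tilde\Xi^n$ (product in $KS_n$). *)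

(* Defs.v *)
From HB Require Import structures.
From mathcomp Require Import all_boot all_order all_algebra all_fingroup.

Set Implicit Arguments.
Unset Strict Implicit.
Unset Printing Implicit Defensive.

Import GRing.Theory.
Local Open Scope ring_scope.

(* The group algebra K[gT].  The alias keeps the convolution product defined
   here separate from any pointwise product on {ffun gT -> K}. *)
Definition galg (K : fieldType) (gT : finGroupType) : Type := {ffun gT -> K^o}.

HB.instance Definition _ (K : fieldType) (gT : finGroupType) :=
  GRing.Lmodule.copy (galg K gT) {ffun gT -> K^o}.

Section GroupAlgebra.
Variables (K : fieldType) (gT : finGroupType).
Implicit Types (a b c : galg K gT) (x y z : gT).

Definition gcoef a x : K := (a : {ffun gT -> K^o}) x.

Definition gbase x : galg K gT := [ffun y => (y == x)%:R].

Definition gmul a b : galg K gT :=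
  [ffun z => \sum_(x : gT) gcoef a x * gcoef b (x^-1 * z)%g].

Lemma gcoefP a b : gcoef a =1 gcoef b -> a = b.
Proof. by move=> eq_ab; apply/ffunP. Qed.

Lemma gcoefM a b z :
  gcoef (gmul a b) z = \sum_x gcoef a x * gcoef b (x^-1 * z)%g.
Proof. exact: ffunE. Qed.

Lemma gcoefD a b z : gcoef (a + b) z = gcoef a z + gcoef b z.
Proof. exact: ffunE. Qed.

Lemma gcoefZ (k : K) a z : gcoef (k *: a) z = k * gcoef a z.
Proof. exact: ffunE. Qed.

Lemma gcoefB x y : gcoef (gbase x) y = (y == x)%:R.
Proof. exact: ffunE. Qed.

Fact gmulA : associative gmul.
Proof.
move=> a b c; apply: gcoefP => z; rewrite !gcoefM.
under eq_bigr => x _ do rewrite gcoefM mulr_sumr.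
under [RHS]eq_bigr => y _ do rewrite gcoefM mulr_suml.
rewrite [RHS]exchange_big /=; apply: eq_bigr => x _.
rewrite [RHS](reindex_inj (mulgI x)) /=; apply: eq_bigr => y _.
by rewrite mulKg invMg !mulgA mulrA.
Qed.

Fact gmul1l : left_id (gbase 1%g) gmul.
Proof.
move=> a; apply: gcoefP => z; rewrite gcoefM (bigD1 1%g) //= big1 => [|x].
  by rewrite gcoefB eqxx mul1r addr0 invg1 mul1g.
by rewrite gcoefB => /negbTE ->; rewrite mul0r.
Qed.

Fact gmul1r : right_id (gbase 1%g) gmul.
Proof.
move=> a; apply: gcoefP => z; rewrite gcoefM (bigD1 z) //= big1 => [|x nzx].
  by rewrite gcoefB mulVg eqxx mulr1 addr0.
by rewrite gcoefB -eq_mulVg1 (negbTE nzx) mulr0.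
Qed.

Fact gmulDl : left_distributive gmul +%R.
Proof.
move=> a b c; apply: gcoefP => z; rewrite gcoefD !gcoefM -big_split.
by apply: eq_bigr => x _; rewrite gcoefD mulrDl.
Qed.

Fact gmulDr : right_distributive gmul +%R.
Proof.
move=> a b c; apply: gcoefP => z; rewrite gcoefD !gcoefM -big_split.
by apply: eq_bigr => x _; rewrite gcoefD mulrDr.
Qed.

Fact gone_neq0 : gbase 1%g != 0.
Proof.
apply/eqP => /(congr1 (gcoef^~ 1%g)); rewrite gcoefB eqxx [RHS]ffunE.
by move/eqP; rewrite oner_eq0.
Qed.

HB.instance Definition _ := GRing.Zmodule_isNzRing.Build (galg K gT)
  gmulA gmul1l gmul1r gmulDl gmulDr gone_neq0.

Fact gscaleAl (k : K) a b : k *: (a * b) = (k *: a) * b.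
Proof.
apply: gcoefP => z; rewrite gcoefZ !gcoefM mulr_sumr.
by apply: eq_bigr => x _; rewrite gcoefZ mulrA.
Qed.

Fact gscaleAr (k : K) a b : k *: (a * b) = a * (k *: b).
Proof.
apply: gcoefP => z; rewrite gcoefZ !gcoefM mulr_sumr.
by apply: eq_bigr => x _; rewrite gcoefZ mulrCA.
Qed.

HB.instance Definition _ :=
  GRing.Lmodule_isLalgebra.Build K (galg K gT) gscaleAl.
HB.instance Definition _ :=
  GRing.Lalgebra_isAlgebra.Build K (galg K gT) gscaleAr.

Lemma gbaseM x y : gbase x * gbase y = gbase (x * y)%g.
Proof.
apply: gcoefP => z; rewrite gcoefM gcoefB (bigD1 x) //= big1 => [|u].
  by rewrite !gcoefB eqxx mul1r addr0 (can2_eq (mulKVg x) (mulKg x)).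
by rewrite gcoefB => /negbTE ->; rewrite mul0r.
Qed.

End GroupAlgebra.

(* 'S_n permutes {0, ..., n-1}; [letter p i] is the image of i under p with
   both arguments and values shifted to {1, ..., n} (and junk value 0 when i is
   out of range).  The product of 'S_n is the one read from left to right,
   (p * q) i = q (p i). *)
Definition letter (n : nat) (p : 'S_n) (i : nat) : nat :=
  if i is j.+1 then if insub j is Some k then (p k).+1 else 0 else 0.

(* The elements i : 'I_n with 0 < i stand for the numbers 1, ..., n-1
   themselves (no shift), so subsets of {1, ..., n-1} or {2, ..., n-1} are
   encoded as elements of {set 'I_n}. *)
Definition Des (n : nat) (p : 'S_n) : {set 'I_n} :=
  [set i : 'I_n | (1 <= i) && (letter p i > letter p i.+1)]%N.

Definition Peak (n : nat) (p : 'S_n) : {set 'I_n} :=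
  [set i : 'I_n | [&& 2 <= i, letter p i.-1 < letter p i
                    & letter p i > letter p i.+1]]%N.

Definition Delta (K : fieldType) (n : nat) (D : {set 'I_n}) : galg K 'S_n :=
  \sum_(p : 'S_n | Des p == D) gbase K p.

Definition Pi (K : fieldType) (n : nat) (P : {set 'I_n}) : galg K 'S_n :=
  \sum_(p : 'S_n | Peak p == P) gbase K p.

Definition Xit (K : fieldType) (n : nat) : galg K 'S_n := 2%:R *: Pi K set0.

Definition omega (K : fieldType) (n : nat) : galg K 'S_n :=
  \sum_(k < n) (-1) ^+ k *: Delta K [set i : 'I_n | (1 <= i <= k)%N].

Definition omegat (K : fieldType) (n : nat) : galg K 'S_n :=
  omega K n * Xit K n.

(* Main.v *)
(* A sign vector e on the values 1, ..., n orders them by the integers e_v v;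
   let r_e be the permutation sending each value to its rank.  Whether
   position i is a descent of z r_e depends only on the sign of the larger of
   the letters number i and i+1 of z.  So asking Des(z r_e) = {1, ..., k}
   leaves the sign of each valley of z free, determines that of every letter
   which is neither a peak nor a valley, and puts two conditions on the sign of
   each peak, contradictory unless the peak is at k+1.  As there is one more
   valley than peaks (the ends of the word may be valleys),
     #{e | Des(z r_e) = {1, ..., k}} = 2^(#Peak(z) + 1) if Peak(z) is contained
     in {k+1}, and 0 otherwise.
   For k = 0 this says that twice the sum of the permutations without peaks is
   the sum of all r_e^-1.  Hence the coefficient of z in the product of omega
   with it is the alternating sum over k of the same numbers. *)
Require Import Defs.
From HB Require Import structures.
From mathcomp Require Import all_boot all_order all_algebra all_fingroup.
From mathcomp Require Import zify.

Set Implicit Arguments.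
Unset Strict Implicit.
Unset Printing Implicit Defensive.

Import GRing.Theory.
Local Open Scope ring_scope.

(** * Ranking by an injective key *)

Section Rank.
Variables (n : nat) (f : 'I_n -> nat).
Hypothesis f_inj : injective f.

Fact rank_subproof (v : 'I_n) : (#|[set u | (f u < f v)%N]| < n)%N.
Proof.
rewrite -[X in (_ < X)%N]card_ord -cardsT; apply: proper_card.
by apply/properP; split; [exact: subsetT | exists v; rewrite !inE ?ltnn].
Qed.

Definition rank (v : 'I_n) : 'I_n := Ordinal (rank_subproof v).

Lemma ltn_rank (u v : 'I_n) : (rank u < rank v)%N = (f u < f v)%N.
Proof.
have rank_lt (a b : 'I_n) : (f a < f b -> rank a < rank b)%N.
  move=> lt_ab; apply: proper_card; apply/properP; split.
    by apply/subsetP=> c; rewrite !inE => /ltn_trans->.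
  by exists a; rewrite !inE ?ltnn.
case: (ltngtP (f u) (f v)) => [/rank_lt|/rank_lt|/f_inj ->]; last by rewrite ltnn.
- by move->.
- by move=> lt_vu; apply/negbTE; rewrite -leqNgt ltnW.
Qed.

Lemma rank_inj : injective rank.
Proof.
move=> u v eq_uv; apply: f_inj; apply/eqP.
by rewrite eqn_leq leqNgt -ltn_rank eq_uv ltnn leqNgt -ltn_rank eq_uv ltnn.
Qed.

End Rank.

(** * Descent sets read off adjacent entries *)

Lemma letterS n (p : 'S_n) (i : 'I_n) : letter p i.+1 = (p i).+1.
Proof.
by rewrite /letter; case: insubP => [j _ /ord_inj->|]; rewrite ?ltn_ord.
Qed.

(* The entries at the 0-based positions i and i.+1 are the 1-based letters
   number i.+1 and i.+2. *)
Lemma letter_desc n (p : 'S_n) (i j : 'I_n) :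
  j = i.+1 :> nat -> (letter p j > letter p j.+1)%N = (p j < p i)%N.
Proof. by move=> def_j; rewrite letterS def_j letterS ltnS. Qed.

Lemma Des_init n (p : 'S_n) (k : nat) :
  (Des p == [set i : 'I_n | (1 <= i <= k)%N]) =
  [forall i : 'I_n, forall j : 'I_n,
     (j == i.+1 :> nat) ==> ((p j < p i) == (j <= k))%N].
Proof.
apply/eqP/'forall_'forall_implyP => [eqD i j /eqP def_j | desP].
  have /setP/(_ j) := eqD; rewrite !inE (letter_desc _ def_j).
  by have -> : (0 < j)%N; [rewrite def_j | move=> /= ->].
apply/setP=> j; rewrite !inE; case: (posnP j) => //= j_gt0.
have lt_i : (j.-1 < n)%N by rewrite (leq_ltn_trans (leq_pred j)).
have def_j : j = (Ordinal lt_i).+1 :> nat by rewrite /= prednK.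
rewrite (letter_desc _ def_j); apply: (eqP (desP (Ordinal lt_i) j _)).
by rewrite {1}def_j.
Qed.

Lemma Des_eq0 n (p : 'S_n) : (Des p == set0) = (p == 1%g).
Proof.
have -> : set0 = [set i : 'I_n | (1 <= i <= 0)%N].
  by apply/setP=> i; rewrite !inE; case: (i : nat).
rewrite Des_init; apply/idP/eqP => [/'forall_'forall_implyP asc | ->]; last first.
  by apply/'forall_'forall_implyP=> i j /eqP def_j; rewrite !perm1 def_j; lia.
have p_le (d : nat) (i j : 'I_n) : (j = i + d :> nat -> p i <= p j)%N.
  elim: d j => [|d IHd] j def_j; first by have -> : j = i by apply: ord_inj; lia.
  have lt_j' : (i + d < n)%N by have := ltn_ord j; lia.
  apply: leq_trans (IHd (Ordinal lt_j') erefl) _.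
  have -> : (p (Ordinal lt_j') <= p j)%N = ~~ (p j < p (Ordinal lt_j'))%N.
    by rewrite -leqNgt.
  by rewrite (eqP (asc (Ordinal lt_j') j _)) /= ?def_j ?addnS.
have p_mono (i j : 'I_n) : (p i < p j)%N = (i < j)%N.
  have p_le' (a b : 'I_n) : (a <= b -> p a <= p b)%N.
    by move=> le_ab; apply: (p_le (b - a)%N); lia.
  apply/idP/idP=> [|lt_ij]; first by rewrite !ltnNge; apply/contra/p_le'.
  rewrite ltn_neqAle p_le' 1?ltnW // andbT (inj_eq val_inj) (inj_eq perm_inj).
  by rewrite neq_ltn lt_ij.
have card_lt (a : 'I_n) : #|[set b : 'I_n | (b < a)%N]| = a.
  rewrite -sum1dep_card -(big_ord_widen n (fun=> 1%N)) 1?ltnW //.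
  by rewrite sum1_card card_ord.
(* An increasing [p] maps the elements below [i] onto those below [p i]; both sets have the same
   size, so [p i = i]. *)
apply/permP=> i; apply: val_inj; rewrite perm1 /= -[LHS]card_lt -[RHS]card_lt.
rewrite -[RHS](card_imset _ (@perm_inj _ p)); apply: eq_card => b.
rewrite inE; apply/idP/imsetP => [lt_b | [a]].
  by exists (p^-1 b)%g; rewrite ?permKV // inE -p_mono permKV.
by rewrite inE => lt_ai ->; rewrite p_mono.
Qed.

(* The values v : 'I_n are ranked by +(v + 1) or -(v + 1) according to the sign
   e v; the keys below are these integers, shifted to nat. *)
Definition sign_key n (e : {ffun 'I_n -> bool}) (v : 'I_n) : nat :=
  if e v then (n + v)%N else (n - v.+1)%N.

Lemma sign_key_inj n (e : {ffun 'I_n -> bool}) : injective (sign_key e).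
Proof.
move=> u v; have := ltn_ord u; have := ltn_ord v.
by rewrite /sign_key; case: (e u); case: (e v) => *; apply: ord_inj; lia.
Qed.

Definition sign_perm n (e : {ffun 'I_n -> bool}) : 'S_n :=
  perm (rank_inj (@sign_key_inj n e)).

(** The larger of two values has the integer of larger absolute value, so its sign alone decides the
    comparison. *)
Lemma ltn_sign_perm n (e : {ffun 'I_n -> bool}) (u v : 'I_n) : u != v ->
  (sign_perm e v < sign_perm e u)%N = (if (v < u)%N then e u else ~~ e v).
Proof.
move=> neq_uv; rewrite !permE ltn_rank; last exact: sign_key_inj.
have {neq_uv} : (u != v :> nat) by [].
have := ltn_ord u; have := ltn_ord v; rewrite /sign_key.
by case: (ltngtP v u); case: (e u); case: (e v) => //=; lia.
Qed.

(** * Counting sign vectors with a prescribed initial descent set *)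

Section SignCount.
Variables (m : nat) (z : 'S_m.+1).
Implicit Types (i j : 'I_m.+1) (e : {ffun 'I_m.+1 -> bool}).

(* [desc] takes a 1-based index, whereas [lasc i] and [rdesc i] compare the
   letter at the 0-based position i (the letter number i.+1) with its left and
   right neighbours. *)
Let desc (i : nat) : bool := (letter z i > letter z i.+1)%N.
Let lasc (i : nat) : bool := (0 < i)%N && ~~ desc i.
Let rdesc (i : nat) : bool := (i < m)%N && desc i.+1.

Let descE i j : j = i.+1 :> nat -> desc j = (z j < z i)%N.
Proof. exact: letter_desc. Qed.

Lemma in_Peak j : (j \in Peak z) = [&& (0 < j)%N, lasc j.-1 & rdesc j.-1].
Proof.
rewrite inE /lasc /rdesc /desc.
(* [lasc] only denies a descent; distinctness of adjacent letters gives the strict ascent required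
   by [Peak]. *)
have neq_letter i j' : j' = i.+1 :> nat -> letter z i.+1 != letter z j'.+1.
  move=> def_j'; rewrite !letterS eqSS (inj_eq val_inj) (inj_eq perm_inj).
  by apply/eqP=> eq_ij; move: def_j'; rewrite eq_ij => /n_Sn.
have {}neq_letter (i : nat) : (i.+1 < m.+1)%N -> letter z i.+1 != letter z i.+2.
  by move=> lt_i; apply: (neq_letter (Ordinal (ltnW lt_i)) (Ordinal lt_i)).
move: (letter z) neq_letter => L neq_L; case: j => [[|[|i]] lt_i] //=.
rewrite -leqNgt [in RHS]leq_eqVlt (negPf (neq_L i (ltnW lt_i))).
by have -> : (i.+1 < m)%N by [].
Qed.

(** Each adjacent pair constrains only the sign at its larger entry. If that entry is on the right,
    at [i], the pair has 1-based index [i]; if it is on the left, the index is [i.+1], whence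
    [i < k]. *)
Lemma Des_sign_permP e (k : nat) :
  reflect (forall i, (lasc i -> ~~ e (z i) = (i <= k)%N) /\
                     (rdesc i -> e (z i) = (i < k)%N))
    (Des (z * sign_perm e)%g == [set i : 'I_m.+1 | (1 <= i <= k)%N]).
Proof.
have compE i j : j = i.+1 :> nat ->
    ((z * sign_perm e)%g j < (z * sign_perm e)%g i)%N =
    (if desc j then e (z i) else ~~ e (z j)).
  move=> def_j; rewrite !permM ltn_sign_perm -?descE //.
  rewrite (inj_eq perm_inj); apply/eqP=> eq_ij.
  by move: def_j; rewrite eq_ij => /n_Sn.
rewrite Des_init; apply: (iffP 'forall_'forall_implyP) => eqD.
  move=> i; split=> /andP[].
    move=> i_gt0 /negbTE asc_i.
    have lt_i : (i.-1 < m.+1)%N by have := ltn_ord i; lia.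
    have def_i : i = (Ordinal lt_i).+1 :> nat by rewrite /= prednK.
    have := eqD (Ordinal lt_i) i; rewrite compE // asc_i => eqDi.
    by apply/eqP/eqDi; apply/eqP.
  move=> lt_i des_i; have lt_i' : (i.+1 < m.+1)%N by [].
  have := eqD i (Ordinal lt_i'); rewrite compE // des_i => eqDi.
  by apply/eqP/eqDi; apply/eqP.
move=> i j /eqP def_j; rewrite compE //; apply/eqP.
have [/(_ _)/= _ eqi] := eqD i; have [eqj _] := eqD j.
case: ifPn => [des_j | asc_j]; last first.
  by apply: eqj; rewrite /lasc asc_j andbT def_j.
by rewrite eqi ?def_j // /rdesc -def_j des_j andbT -ltnS ltn_ord.
Qed.

(** Each of the [m] adjacent pairs has one larger entry, so [lasc + rdesc] sums to [m]. Pointwise,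
    valley + [lasc] + [rdesc] = peak + 1. *)
Lemma sum_valley :
  (\sum_(i < m.+1) (~~ lasc i && ~~ rdesc i) = #|Peak z|.+1)%N.
Proof.
have cardP : #|Peak z| = (\sum_(i < m.+1) (lasc i && rdesc i))%N.
  rewrite -sum1_card big_mkcond /= big_ord_recl in_Peak add0n.
  rewrite [RHS]big_ord_recr /= /rdesc ltnn andbF addn0.
  by apply: eq_bigr => i _; rewrite in_Peak /=; case: ifP.
have sum_asc : (\sum_(i < m.+1) (lasc i + rdesc i) = m)%N.
  rewrite big_split /= big_ord_recl big_ord_recr /= /rdesc ltnn add0n addn0.
  rewrite -big_split /= -[RHS]card_ord -sum1_card; apply: eq_bigr => i _.
  by rewrite /lasc ltn_ord; case: (desc _).
apply/eqP; rewrite -(eqn_add2r m) -[X in (_ + X)%N]sum_asc -big_split /=.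
rewrite addSn -addnS cardP -[X in (_ + X)%N]card_ord -sum1_card -big_split /=.
by apply/eqP/eq_bigr=> i _; case: (lasc i); case: (rdesc i).
Qed.

Lemma card_sign_perm_Des (k : nat) :
  #|[set e | Des (z * sign_perm e)%g == [set i : 'I_m.+1 | (1 <= i <= k)%N]]| =
  ((Peak z \subset [set i : 'I_m.+1 | i == k.+1 :> nat]) * 2 ^ #|Peak z|.+1)%N.
Proof.
(* The conditions separate by position: [A i] is the set of signs allowed at position [i], and the
   count is the product of the [#|A i|]. *)
pose A i : pred bool :=
  [pred b | (lasc i ==> (~~ b == (i <= k))%N) && (rdesc i ==> (b == (i < k)%N))].
have -> : #|[set e | Des (z * sign_perm e)%g ==
                     [set i : 'I_m.+1 | (1 <= i <= k)%N]]| =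
  #|family (fun v => A ((z^-1)%g v))|.
  apply: eq_card => e; rewrite inE.
  apply/Des_sign_permP/familyP => [eqD v | eqD i].
    have [eql eqr] := eqD ((z^-1)%g v); rewrite !permKV in eql eqr.
    rewrite inE; apply/andP; split; apply/implyP.
      by move/eql=> ->.
    by move/eqr=> ->.
  have := eqD (z i); rewrite inE permK => /andP[/implyP eql /implyP eqr].
  by split=> [/eql/eqP | /eqr/eqP].
(* At a peak the two conditions agree exactly when [i = k]; a valley leaves both signs free. *)
have cardA i : #|A i| = (((lasc i && rdesc i) ==> (i == k :> nat))
                          * 2 ^ (~~ lasc i && ~~ rdesc i))%N.
  rewrite -sum1_card big_mkcond big_bool /= !inE /=.
  by case: (lasc i); case: (rdesc i); case: ltngtP.
rewrite card_family foldrE big_map big_enum /=.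
rewrite (reindex_inj (@perm_inj _ z)) /=.
under eq_bigr do rewrite permK cardA.
rewrite big_split /= -expn_sum sum_valley; congr (_ * _)%N.
case: subsetP => [sub | nsub].
  apply: big1 => i _; case: implyP => // -[] /andP[lasc_i rdesc_i].
  have lt_i : (i.+1 < m.+1)%N by case/andP: rdesc_i.
  have := sub (Ordinal lt_i); rewrite in_Peak /= lasc_i rdesc_i inE /= eqSS.
  exact.
apply/eqP; rewrite -leqn0 leqNgt; apply/negP=> prod_gt0; case: nsub => j.
rewrite in_Peak inE => /and3P[j_gt0 lasc_j rdesc_j].
have lt_j : (j.-1 < m.+1)%N by have := ltn_ord j; lia.
move: prod_gt0; rewrite (bigD1 (Ordinal lt_j)) //= lasc_j rdesc_j /=.
by case: eqP => // <- _; rewrite prednK.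
Qed.

End SignCount.

(** * Coefficients in the group algebra *)

Section GroupAlgebraCoefficients.
Variables (K : fieldType) (gT : finGroupType).

Lemma gcoef_sum (I : finType) (P : pred I) (F : I -> galg K gT) (x : gT) :
  gcoef (\sum_(i | P i) F i) x = \sum_(i | P i) gcoef (F i) x.
Proof.
have gcoef0 : gcoef (0 : galg K gT) x = 0 by exact: ffunE.
exact: (big_morph (fun a => gcoef a x) (fun a b => gcoefD a b x) gcoef0).
Qed.

Lemma gcoef_sum_gbase (P : pred gT) (x : gT) :
  gcoef (\sum_(y | P y) gbase K y) x = (P x)%:R.
Proof.
rewrite gcoef_sum; under eq_bigr do rewrite gcoefB.
have [Px | nPx] := boolP (P x).
  rewrite (bigD1 x) //= eqxx big1 ?addr0 // => y /andP[_ neq_yx].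
  by rewrite eq_sym (negPf neq_yx).
by apply: big1 => y Py; case: eqP => // eq_xy; rewrite eq_xy Py in nPx.
Qed.

Lemma gcoef_mul_gbase (a : galg K gT) (x y : gT) :
  gcoef (a * gbase K x) y = gcoef a (y * x^-1)%g.
Proof.
rewrite gcoefM (bigD1 (y * x^-1)%g) //= gcoefB invMg invgK mulgKV eqxx mulr1.
rewrite big1 ?addr0 // => u neq_u; rewrite gcoefB.
case: eqP => [def_x | _]; last by rewrite mulr0.
by rewrite -def_x invMg invgK mulKVg eqxx in neq_u.
Qed.

End GroupAlgebraCoefficients.

Section OmegaXi.
Variables (K : fieldType) (m : nat).
Implicit Type z : 'S_m.+1.

Lemma Xit_sign_perm :
  Xit K m.+1 = \sum_(e : {ffun 'I_m.+1 -> bool}) gbase K (sign_perm e)^-1%g.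
Proof.
apply: gcoefP => z; rewrite gcoefZ gcoef_sum_gbase gcoef_sum.
under eq_bigr do rewrite gcoefB.
rewrite -natr_sum -natrM -big_mkcond sum1dep_card; congr _%:R.
have -> : [set e | z == (sign_perm e)^-1%g] =
  [set e | Des (z * sign_perm e)%g == [set i : 'I_m.+1 | (1 <= i <= 0)%N]].
  apply/setP=> e; rewrite !inE.
  have -> : [set i : 'I_m.+1 | (1 <= i <= 0)%N] = set0.
    by apply/setP=> i; rewrite !inE; case: (i : nat).
  by rewrite Des_eq0 [LHS]eq_mulgV1 invgK.
rewrite card_sign_perm_Des.
(* For [k = 0] the only admissible peak would be 1, while peaks are at least 2. *)
have [-> | nz] := eqVneq (Peak z) set0; first by rewrite sub0set cards0.
have [p Pp] := set0Pn _ nz; case: subsetP => // /(_ p Pp).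
by rewrite inE => /eqP def_p; rewrite inE def_p in Pp.
Qed.

Lemma gcoef_omegat z :
  gcoef (omegat K m.+1) z =
  \sum_(k < m.+1) (-1) ^+ k *
    ((Peak z \subset [set i : 'I_m.+1 | i == k.+1 :> nat])
       * 2 ^ #|Peak z|.+1)%:R.
Proof.
rewrite /omegat Xit_sign_perm mulr_sumr gcoef_sum.
under eq_bigr => e _.
  rewrite gcoef_mul_gbase invgK gcoef_sum.
  under eq_bigr do rewrite gcoefZ gcoef_sum_gbase.
  over.
rewrite exchange_big /=; apply: eq_bigr => k _.
rewrite -mulr_sumr -natr_sum -big_mkcond sum1dep_card; congr (_ * _%:R).
exact: card_sign_perm_Des.
Qed.

End OmegaXi.

(** * Comparison of coefficients *)

Lemma sum_signr (K : pzRingType) (n : nat) :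
  \sum_(k < n) (-1) ^+ k = (odd n)%:R :> K.
Proof.
elim: n => [|n IHn]; first by rewrite big_ord0.
rewrite big_ord_recr /= IHn -signr_odd.
by case: (odd n); rewrite ?expr1 ?subrr ?add0r.
Qed.

Lemma gcoef_Pi (K : fieldType) (n : nat) (P : {set 'I_n}) (z : 'S_n) :
  gcoef (Pi K P) z = (Peak z == P)%:R.
Proof. exact: gcoef_sum_gbase. Qed.

Theorem proposition7p3 (K : fieldType) (charK0 : [pchar K] =i pred0)
    (n : nat) (n_odd : odd n) :
  (2 * n)%:R^-1 *: omegat K n =
  n%:R^-1 *: (Pi K set0
    + 2%:R *: \sum_(k < n | (2 <= k)%N) (-1) ^+ k.-1 *: Pi K [set k])
    :> galg K 'S_n.
Proof.
have nz2 : 2%:R != 0 :> K by have /pcharf0P-> := charK0.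
rewrite natrM invfM mulrC -scalerA; congr (_ *: _).
apply: (scalerI nz2); rewrite scalerA mulfV // scale1r.
case: n n_odd => // m m_even; apply: gcoefP => z.
rewrite gcoef_omegat gcoefZ gcoefD gcoefZ gcoef_Pi gcoef_sum.
under [in RHS]eq_bigr do rewrite gcoefZ gcoef_Pi.
have [P0 | nP0] := eqVneq (Peak z) set0.
  rewrite P0 cards0 [X in _ + 2%:R * X]big1 ?mulr0 ?addr0 ?mulr1; last first.
    move=> k _; rewrite (_ : set0 == [set k] = false) ?mulr0 //.
    by apply/eqP=> /setP/(_ k); rewrite !inE eqxx.
  (* Every [k] contributes 2 with alternating signs; as [n] is odd, the total is 2. *)
  under eq_bigr do rewrite sub0set.
  by rewrite -mulr_suml sum_signr m_even mul1r.
rewrite add0r mulrA -natrM.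
have [p Pp] := set0Pn _ nP0.
have lt1p : (1 < p)%N by move: Pp; rewrite inE => /andP[].
have lt_p : (p.-1 < m.+1)%N by rewrite (leq_ltn_trans (leq_pred p)).
have def_p : p = p.-1.+1 :> nat by rewrite prednK // ltnW.
(* With the single peak [p], only [k = p.-1] survives on the left, and both sides equal 4 up to the
   same sign. With more peaks both sides vanish. *)
have [P1 | nP1] := eqVneq (Peak z) [set p].
  rewrite (bigD1 (Ordinal lt_p)) //= [X in _ + X]big1 ?addr0; last first.
    move=> k neq_k; rewrite P1 sub1set inE.
    case: eqP => [def_k|_]; last by rewrite mul0n mulr0.
    by case/eqP: neq_k; apply: ord_inj; rewrite /= def_k.
  rewrite [in RHS](bigD1 p) //= [X in _ * (_ + X)]big1 ?addr0; last first.
    move=> k /andP[_ neq_k]; rewrite P1 (inj_eq set1_inj) eq_sym (negPf neq_k).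
    by rewrite mulr0.
  by rewrite P1 eqxx sub1set inE -def_p eqxx cards1 mul1n mulr1 mulrC.
rewrite [in RHS]big1 ?mulr0 => [|k _]; last first.
  case: eqP => [Pk|_]; last by rewrite mulr0.
  by case/eqP: nP1; rewrite Pk; move: Pp; rewrite Pk inE => /eqP->.
apply: big1 => k _; case: subsetP => [sub|_]; last by rewrite mul0n mulr0.
case/eqP: nP1; apply/setP=> j; rewrite inE; apply/idP/eqP => [Pj|-> //].
have := sub p Pp; have := sub j Pj; rewrite !inE => /eqP def_j /eqP def_p'.
by apply: ord_inj; rewrite def_j.
Qed.
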